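(* Let $\mathbf{A}$ be an implicator groupoid. Then $\mathbf{A}$ is an implication algebra in the sense of Abbott if and only if $\mathbf{A}$ is a Boolean algebra.
   Context: An implicator groupoid is an algebra $\mathbf A = \langle A, \to, 0 \rangle$, with $\to$ binary and $0$ a constant, which, writing $x' := x \to 0$, satisfies the identities (I) $(x \to y) \to z \approx [(z' \to x) \to (y \to z)']'$ and (I$_0$) $0'' \approx 0$. Following the paper, an implicator groupoid is called a De Morgan algebra if it satisfies $(x \to y) \to x \approx x$, and a Boolean algebra if it is a De Morgan algebra and satisfies $x \to x \approx 0'$. An algebra $\langle A, \to, 0\rangle$ is an implication algebra in the sense of Abbott if it satisfies: (1) $(x \to y) \to x \approx x$; (2) $(x \to y) \to y \approx (y \to x) \to x$; (3) $x \to (y \to z) \approx y \to (x \to z)$. *)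

(* Defs.v *)
Set Implicit Arguments.
Unset Strict Implicit.

(* Algebras of type (2, 0), in the language of the operation -> and 0. *)
Record algebra : Type := Algebra {
  carrier :> Type;
  imp : carrier -> carrier -> carrier;
  zero : carrier
}.

Arguments imp {a} x y.
Arguments zero {a}.

Declare Scope implicator_scope.
Delimit Scope implicator_scope with I.
Open Scope implicator_scope.

Notation "x ~> y" := (imp x y) (at level 55, no associativity) : implicator_scope.
Notation "0" := zero : implicator_scope.

Definition neg {A : algebra} (x : A) : A := x ~> 0.

Record implicator_groupoid (A : algebra) : Prop := {
  identity_I : forall x y z : A,
    (x ~> y) ~> z = neg ((neg z ~> x) ~> neg (y ~> z));
  identity_I0 : neg (neg (0 : A)) = 0
}.

Record de_morgan_algebra (A : algebra) : Prop := {
  de_morgan_implicator : implicator_groupoid A;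
  de_morgan_absorption : forall x y : A, (x ~> y) ~> x = x
}.

Record boolean_algebra (A : algebra) : Prop := {
  boolean_de_morgan : de_morgan_algebra A;
  boolean_refl : forall x : A, x ~> x = neg 0
}.

(* Implication algebras in the sense of Abbott: the constant 0 belongs to the
   language but is not constrained by the axioms. *)
Record implication_algebra (A : algebra) : Prop := {
  abbott_contraction : forall x y : A, (x ~> y) ~> x = x;
  abbott_quasi_commutativity : forall x y : A, (x ~> y) ~> y = (y ~> x) ~> x;
  abbott_exchange : forall x y z : A, x ~> (y ~> z) = y ~> (x ~> z)
}.

(* Main.v *)
Require Import Defs.

(** In an implication algebra the terms [x ~> x] all name one element, so
    [x ~> x = 0 ~> 0 = neg 0]; absorption is Abbott's first axiom, and an
    implicator groupoid satisfying Abbott's axioms is therefore Boolean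
    ([implication_refl_const]).

    For the converse, put [join x y := neg x ~> y] and
    [meet x y := neg (x ~> neg y)].  In a De Morgan algebra [neg] is an
    involution and contraposition holds, so [join] and [meet] are commutative
    and dual to each other under [neg].  Identity (I) then says that [join]
    distributes over [meet], and [(x ~> y) ~> x = x] becomes lattice
    absorption.  Absorption and distributivity force [join] to be associative
    ([join_assoc]), and exchange is associativity together with commutativity of
    [join].  Quasi-commutativity comes from [x ~> x = neg 0], which
    reduces (I), taken at [z = y], to [(x ~> y) ~> y = join y x]. *)

(** Both [x ~> y] and [(x ~> y) ~> y] have the same self-implication as [x],
    and by quasi-commutativity the latter term is symmetric in [x] and [y]. *)
Lemma implication_refl_const {A : algebra} (HA : implication_algebra A) :
  forall x y : A, x ~> x = y ~> y.
Proof.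
  destruct HA as [contr qcomm _].
  assert (contr2 : forall x y : A, x ~> (x ~> y) = x ~> y).
  { intros x y. pose proof (contr (x ~> y) x) as H.
    rewrite (contr x y) in H. exact H. }
  assert (step : forall x y : A, x ~> x = (x ~> y) ~> (x ~> y)).
  { intros x y. pose proof (qcomm x (x ~> y)) as H.
    rewrite contr2, contr in H. symmetry. exact H. }
  intros x y.
  rewrite (step x y), (step (x ~> y) y), qcomm.
  rewrite <- (step (y ~> x) x), <- (step y x). reflexivity.
Qed.

Definition join {A : algebra} (x y : A) : A := neg x ~> y.
Definition meet {A : algebra} (x y : A) : A := neg (x ~> neg y).

Section DeMorgan.

Context {A : algebra}.
Context (HA : de_morgan_algebra A).

Let idI := identity_I (de_morgan_implicator HA).
Let absorption := de_morgan_absorption HA.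

Lemma neg_zero_imp (y : A) : neg (0 ~> y) = 0.
Proof. exact (absorption 0 y). Qed.

(** Identity (I) at [(x ~> 0) ~> x]: absorption evaluates both this term and the
    inner [neg x ~> x] to [x], and [neg (0 ~> x)] to [0]. *)
Lemma neg_involutive (x : A) : neg (neg x) = x.
Proof.
  pose proof (idI x 0 x) as H.
  rewrite neg_zero_imp in H.
  change (neg x ~> x) with ((x ~> 0) ~> x) in H.
  rewrite absorption in H.
  symmetry. exact H.
Qed.

(** Identity (I) with [y = 0], where [neg (0 ~> y)] collapses to [0]. *)
Lemma join_comm (x y : A) : join x y = join y x.
Proof.
  unfold join. change (neg x ~> y) with ((x ~> 0) ~> y).
  rewrite idI, neg_zero_imp. apply neg_involutive.
Qed.

Lemma contraposition (x y : A) : x ~> neg y = y ~> neg x.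
Proof.
  pose proof (join_comm (neg x) (neg y)) as H.
  unfold join in H. rewrite !neg_involutive in H. exact H.
Qed.

Lemma meet_comm (x y : A) : meet x y = meet y x.
Proof. unfold meet. now rewrite contraposition. Qed.

Lemma neg_join (x y : A) : neg (join x y) = meet (neg x) (neg y).
Proof. unfold join, meet. now rewrite neg_involutive. Qed.

Lemma neg_meet (x y : A) : neg (meet x y) = join (neg x) (neg y).
Proof. unfold join, meet. now rewrite !neg_involutive. Qed.

(** After one contraposition this is identity (I) for [(x ~> neg y) ~> z]. *)
Lemma join_meet_distr (z x y : A) :
  join z (meet x y) = meet (join z x) (join z y).
Proof.
  rewrite (join_comm z (meet x y)), (join_comm z y).
  unfold join, meet. rewrite neg_involutive. apply idI.
Qed.

Lemma meet_join_distr (z x y : A) :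
  meet z (join x y) = join (meet z x) (meet z y).
Proof.
  rewrite <- (neg_involutive (meet z (join x y))).
  rewrite (neg_meet z (join x y)), (neg_join x y), join_meet_distr.
  rewrite (neg_meet (join (neg z) (neg x)) (join (neg z) (neg y))).
  now rewrite (neg_join (neg z) (neg x)), (neg_join (neg z) (neg y)),
    !neg_involutive.
Qed.

Lemma join_meet_absorb (x y : A) : join x (meet x y) = x.
Proof.
  rewrite join_comm. unfold join, meet.
  rewrite neg_involutive. apply absorption.
Qed.

Lemma meet_join_absorb (x y : A) : meet x (join x y) = x.
Proof.
  rewrite <- (neg_involutive (meet x (join x y))).
  rewrite (neg_meet x (join x y)), (neg_join x y), join_meet_absorb.
  apply neg_involutive.
Qed.

Lemma meet_join_nested_absorb (x y z : A) : meet x (join (join x y) z) = x.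
Proof.
  rewrite meet_join_distr, meet_join_absorb. apply join_meet_absorb.
Qed.

(** Each of [x], [y], [z] absorbs both bracketings [u] and [v] of their join,
    so distributing [meet u v] over the summands of [u] gives [u], and
    distributing it over the summands of [v] gives [v]. *)
Lemma join_assoc (x y z : A) : join x (join y z) = join (join x y) z.
Proof.
  set (u := join x (join y z)). set (v := join (join x y) z).
  assert (xu : meet u x = x).
  { rewrite meet_comm. apply meet_join_absorb. }
  assert (yu : meet u y = y).
  { unfold u. rewrite meet_comm, join_comm. apply meet_join_nested_absorb. }
  assert (zu : meet u z = z).
  { unfold u. rewrite meet_comm, join_comm, (join_comm y z).
    apply meet_join_nested_absorb. }
  assert (xv : meet v x = x).
  { rewrite meet_comm. apply meet_join_nested_absorb. }
  assert (yv : meet v y = y).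
  { unfold v. rewrite meet_comm, (join_comm x y).
    apply meet_join_nested_absorb. }
  assert (zv : meet v z = z).
  { unfold v. rewrite meet_comm, join_comm. apply meet_join_absorb. }
  transitivity (meet u v).
  - rewrite meet_comm. unfold u.
    now rewrite !meet_join_distr, xv, yv, zv.
  - unfold v. now rewrite !meet_join_distr, xu, yu, zu.
Qed.

Lemma de_morgan_exchange (x y z : A) : x ~> (y ~> z) = y ~> (x ~> z).
Proof.
  assert (imp_join : forall a b : A, a ~> b = join (neg a) b).
  { intros a b. unfold join. now rewrite neg_involutive. }
  rewrite !imp_join, !join_assoc.
  now rewrite (join_comm (neg x) (neg y)).
Qed.

End DeMorgan.

(** Here [neg (y ~> y) = neg (neg 0) = 0] removes the second factor of (I). *)
Lemma boolean_imp_imp_join {A : algebra} (HA : boolean_algebra A) (x y : A) :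
  (x ~> y) ~> y = join y x.
Proof.
  pose proof (boolean_de_morgan HA) as HM.
  rewrite (identity_I (de_morgan_implicator HM)).
  rewrite (boolean_refl HA), (neg_involutive HM).
  apply (neg_involutive HM).
Qed.

Theorem theorem2p10 (A : algebra) (HA : implicator_groupoid A) :
  implication_algebra A <-> boolean_algebra A.
Proof.
  split; intro H.
  - split.
    + split; [exact HA | exact (abbott_contraction H)].
    + intro x. exact (implication_refl_const H x 0).
  - pose proof (boolean_de_morgan H) as HM.
    split.
    + exact (de_morgan_absorption HM).
    + intros x y. rewrite !(boolean_imp_imp_join H).
      apply (join_comm HM).
    + exact (de_morgan_exchange HM).
Qed.
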